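(* Let $(r_1,r_2,r_3,r_4)$ be positive real numbers. There exists a Steiner $4$-chain $\delta_1,\delta_2,\delta_3,\delta_4$ (for some pair of parent circles) in which $\delta_j$ has radius $r_j$ for $j=1,2,3,4$ if and only if the quadruple $(r_1,r_2,r_3,r_4)$ passes the following feasibility test. Put $b_j=1/r_j$ and $I_k=\sum_{j=1}^4 b_j^k$ for $k=1,2,3$. There is a real root $a$ of $$16a^2-8I_1a+(8I_2-3I_1^2)=0$$ such that, with $A=\frac{I_1}{2}-a$, $\tilde r=\frac1a$, $\tilde R=-\frac1A$, the following hold: (i) $a>0$, $A<0$, $\tilde R>\tilde r$ and $\tilde R^2-6\tilde R\tilde r+\tilde r^2>0$; put $\tilde d=\sqrt{\tilde R^2-6\tilde R\tilde r+\tilde r^2}$; (ii) each $r_j$ lies in the interval $\left[\frac{\tilde R-\tilde d-\tilde r}{2},\frac{\tilde R+\tilde d-\tilde r}{2}\right]$; (iii) $I_3=\frac{5A^3+27A^2a+27Aa^2+5a^3}{4}$; (iv) with $u=r_1$, the quadratic $\alpha x^2+\beta x+\gamma$, where $\alpha=4\tilde R^2\tilde r^2u^2$, $\beta=-4\tilde R\tilde r u^2(\tilde R-\tilde r)$, $\gamma=[2\tilde R\tilde r-(\tilde R-\tilde r)u]^2+4\tilde R\tilde r u^2$, has two positive roots $x_+,x_-$ whose reciprocals $1/x_+,1/x_-$ coincide (as a multiset) with $\{r_2,r_4\}$.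
   Context: A Steiner $4$-chain with parent circles $\gamma,\Gamma$ (where $\gamma$ lies inside the interior disk of $\Gamma$) is a sequence of circles $\delta_1,\dots,\delta_4$ such that $\delta_i$ and $\delta_{i+1}$ are externally tangent for all $i$ (indices mod $4$), and each $\delta_i$ is externally tangent to $\gamma$ and internally tangent to $\Gamma$.
   Formalization: The parent circles are required to be non-concentric (for radii (1,1,1,1) a concentric chain exists but (i) fails, with equality to 0), and the four circles of the chain are required to be distinct (δ1,δ2,δ1,δ2 would otherwise be a counterexample). *)

(* Defs.v *)
From Stdlib Require Import Reals List Permutation.
Import ListNotations.
Open Scope R_scope.

Record circle := Circle { center : R * R; radius : R }.

Definition edist (P Q : R * R) : R := dist_euc (fst P) (snd P) (fst Q) (snd Q).

Definition on_circle (P : R * R) (c : circle) : Prop :=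
  edist P (center c) = radius c.

Definition in_open_disk (P : R * R) (c : circle) : Prop :=
  edist P (center c) < radius c.

Definition externally_tangent (c1 c2 : circle) : Prop :=
  edist (center c1) (center c2) = radius c1 + radius c2.

(* [c] touches [C] from inside; the strict inequality excludes [c = C]. *)
Definition internally_tangent (c C : circle) : Prop :=
  radius c < radius C /\ edist (center c) (center C) = radius C - radius c.

(* [NoDup] rules out the degenerate cyclic sequences d1, d2, d1, d4 and
   d1, d2, d3, d2, which satisfy all the tangency conditions between any two
   nested parents [g] and [G] without going round [g]. *)
Definition steiner_4chain (g G d1 d2 d3 d4 : circle) : Prop :=
  Forall (fun c => 0 < radius c) [g; G; d1; d2; d3; d4] /\
  (forall P, on_circle P g -> in_open_disk P G) /\
  NoDup [d1; d2; d3; d4] /\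
  externally_tangent d1 d2 /\ externally_tangent d2 d3 /\
  externally_tangent d3 d4 /\ externally_tangent d4 d1 /\
  Forall (fun d => externally_tangent d g /\ internally_tangent d G)
    [d1; d2; d3; d4].

(* The roots of alpha x^2 + beta x + gamma, listed with multiplicity, are
   [x1] and [x2]; [x1 = x2] is a double root. *)
Definition quadratic_roots (alpha beta gamma x1 x2 : R) : Prop :=
  alpha <> 0 /\
  forall x, alpha * x ^ 2 + beta * x + gamma = alpha * (x - x1) * (x - x2).

Definition power_sum (k : nat) (b1 b2 b3 b4 : R) : R :=
  b1 ^ k + b2 ^ k + b3 ^ k + b4 ^ k.

Definition feasible (r1 r2 r3 r4 : R) : Prop :=
  let I k := power_sum k (1 / r1) (1 / r2) (1 / r3) (1 / r4) in
  exists a : R,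
    16 * a ^ 2 - 8 * I 1%nat * a + (8 * I 2%nat - 3 * I 1%nat ^ 2) = 0 /\
    let A := I 1%nat / 2 - a in
    let rt := 1 / a in
    let Rt := - (1 / A) in
    let dt := sqrt (Rt ^ 2 - 6 * Rt * rt + rt ^ 2) in
    (0 < a /\ A < 0 /\ Rt > rt /\ Rt ^ 2 - 6 * Rt * rt + rt ^ 2 > 0) /\
    Forall (fun rj => (Rt - dt - rt) / 2 <= rj <= (Rt + dt - rt) / 2)
      [r1; r2; r3; r4] /\
    I 3%nat =
      (5 * A ^ 3 + 27 * A ^ 2 * a + 27 * A * a ^ 2 + 5 * a ^ 3) / 4 /\
    let u := r1 in
    let alpha := 4 * Rt ^ 2 * rt ^ 2 * u ^ 2 in
    let beta := - (4 * Rt * rt * u ^ 2 * (Rt - rt)) in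
    let gamma := (2 * Rt * rt - (Rt - rt) * u) ^ 2 + 4 * Rt * rt * u ^ 2 in
    exists xp xm : R,
      quadratic_roots alpha beta gamma xp xm /\
      0 < xp /\ 0 < xm /\
      Permutation [1 / xp; 1 / xm] [r2; r4].

(* Main.v *)
(** Let [rG > r] be the radii of the parents and [d > 0] the distance of their
    centres.  A circle of curvature [b] tangent to both parents has its centre
    on an ellipse whose foci are the centres of the parents; in suitable affine
    coordinates [(z, l)], with [z] an affine function of [b] and [l]
    proportional to [b] times the distance to the axis, these circles are the
    points of a conic [u z^2 + v l^2 = n], and tangency of two of them says that
    the bilinear form of the conic takes a fixed value [k].  If four distinct
    points of such a conic are cyclically related in this way, then opposite
    points are antipodal and [k = 0].  The latter means
    [d^2 = rG^2 - 6 rG r + r^2], and the former gives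
    [b1 + b3 = b2 + b4 = 1/r - 1/rG] together with one quadratic relation between
    [b1] and [b2]; these relations are equivalent to the feasibility test.
    Conversely they allow one to place the four circles at successive quarter
    turns of the conic. *)
Require Import Defs.
From Stdlib Require Import Reals Lra List Permutation.
Import ListNotations.
Open Scope R_scope.

(** * Distances in coordinates *)

Lemma edist_eq_iff (x y x' y' k : R) : 0 <= k ->
  edist (x, y) (x', y') = k <-> (x - x') ^ 2 + (y - y') ^ 2 = k ^ 2.
Proof.
  intros Hk; unfold edist, dist_euc; cbn [fst snd]; unfold Rsqr.
  replace ((x - x') * (x - x') + (y - y') * (y - y'))
    with ((x - x') ^ 2 + (y - y') ^ 2) by ring.
  split; intros H.
  - rewrite <- H, pow2_sqrt; [reflexivity |].
    apply Rplus_le_le_0_compat; apply pow2_ge_0.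
  - rewrite H; apply sqrt_pow2; exact Hk.
Qed.

Lemma edist_triangle (P Q S : R * R) : edist P Q <= edist P S + edist S Q.
Proof. apply triangle. Qed.

(** * Closed quadrilaterals on a conic with constant bilinear product *)

Section WeightedPlane.

Variables u v : R.
Hypotheses (Hu : 0 < u) (Hv : 0 < v).

Lemma orthogonal_to_same_parallel (z l z1 l1 z2 l2 : R) :
  z <> 0 \/ l <> 0 ->
  u * z * z1 + v * l * l1 = 0 -> u * z * z2 + v * l * l2 = 0 ->
  z1 * l2 = l1 * z2.
Proof.
  intros Hne H1 H2.
  assert (Ez : u * z * (z1 * l2 - l1 * z2) = 0).
  { transitivity ((u * z * z1 + v * l * l1) * l2
                  - (u * z * z2 + v * l * l2) * l1); [ring | rewrite H1, H2; ring]. }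
  assert (El : v * l * (z1 * l2 - l1 * z2) = 0).
  { transitivity ((u * z * z2 + v * l * l2) * z1
                  - (u * z * z1 + v * l * l1) * z2); [ring | rewrite H1, H2; ring]. }
  apply Rminus_diag_uniq.
  destruct Hne as [Hz | Hl].
  - apply Rmult_integral in Ez as [E | E]; [exfalso; nra | exact E].
  - apply Rmult_integral in El as [E | E]; [exfalso; nra | exact E].
Qed.

(** The two equations form a linear system in [z'] and [l'] with determinant
    [u * z ^ 2 + v * l ^ 2], positive here. *)
Lemma orthogonal_parallel_zero (z l z' l' : R) :
  z <> 0 \/ l <> 0 ->
  u * z * z' + v * l * l' = 0 -> z * l' = l * z' -> z' = 0 /\ l' = 0.
Proof.
  intros Hne Ho Hp.
  assert (Hpos : u * z ^ 2 + v * l ^ 2 <> 0).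
  { destruct Hne as [H | H].
    - assert (0 < z ^ 2) by nra; assert (0 <= l ^ 2) by nra; nra.
    - assert (0 < l ^ 2) by nra; assert (0 <= z ^ 2) by nra; nra. }
  split; apply (Rmult_eq_reg_l (u * z ^ 2 + v * l ^ 2)); trivial.
  - transitivity (z * (u * z * z' + v * l * l') - v * l * (z * l' - l * z'));
      [ring | rewrite Ho, Hp; ring].
  - transitivity (l * (u * z * z' + v * l * l') + u * z * (z * l' - l * z'));
      [ring | rewrite Ho, Hp; ring].
Qed.

(** Both points lie on one line through the origin, so their sum is parallel to their difference.
    Equal norms make the sum orthogonal to the difference as well, and the difference is nonzero. *)
Lemma same_norm_antipodal (n z l z1 l1 z2 l2 : R) :
  z <> 0 \/ l <> 0 -> z1 <> z2 \/ l1 <> l2 ->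
  u * z1 ^ 2 + v * l1 ^ 2 = n -> u * z2 ^ 2 + v * l2 ^ 2 = n ->
  u * z * z1 + v * l * l1 = 0 -> u * z * z2 + v * l * l2 = 0 ->
  z2 = - z1 /\ l2 = - l1.
Proof.
  intros Hne Hd N1 N2 O1 O2.
  pose proof (orthogonal_to_same_parallel z l z1 l1 z2 l2 Hne O1 O2) as Hp.
  destruct (orthogonal_parallel_zero (z1 - z2) (l1 - l2) (z1 + z2) (l1 + l2)).
  - destruct Hd; [left | right]; lra.
  - lra.
  - lra.
  - lra.
Qed.

(** Points 2 and 4 are both orthogonal to the difference of points 1 and 3, hence antipodal;
    likewise points 1 and 3. The products of point 1 with points 2 and 4 are then opposite, yet both
    equal [k]. *)
Lemma four_cycle_on_conic (n k z1 l1 z2 l2 z3 l3 z4 l4 : R) :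
  u * z1 ^ 2 + v * l1 ^ 2 = n -> u * z2 ^ 2 + v * l2 ^ 2 = n ->
  u * z3 ^ 2 + v * l3 ^ 2 = n -> u * z4 ^ 2 + v * l4 ^ 2 = n ->
  u * z1 * z2 + v * l1 * l2 = k -> u * z2 * z3 + v * l2 * l3 = k ->
  u * z3 * z4 + v * l3 * l4 = k -> u * z4 * z1 + v * l4 * l1 = k ->
  z1 <> z3 \/ l1 <> l3 -> z2 <> z4 \/ l2 <> l4 -> 0 < n ->
  k = 0 /\ z3 = - z1 /\ z4 = - z2 /\ u * (z1 ^ 2 + z2 ^ 2) = n.
Proof.
  intros N1 N2 N3 N4 T12 T23 T34 T41 D13 D24 Hn.
  destruct (same_norm_antipodal n (z1 - z3) (l1 - l3) z2 l2 z4 l4)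
    as [E4 F4]; try lra.
  destruct (same_norm_antipodal n (z2 - z4) (l2 - l4) z1 l1 z3 l3)
    as [E3 F3]; try lra.
  assert (Hk : k = 0) by (subst z4 l4; lra).
  repeat split; trivial.
  apply (Rmult_eq_reg_l n); [| lra].
  (* Squaring the orthogonality of points 1 and 2 allows [l1] and [l2] to be eliminated through the
     conic. *)
  assert (E : (u * z1 * z2) ^ 2 = (v * l1 * l2) ^ 2).
  { replace (u * z1 * z2) with (- (v * l1 * l2)) by lra; ring. }
  assert (E' : (v * l1 * l2) ^ 2 = (n - u * z1 ^ 2) * (n - u * z2 ^ 2)).
  { replace (n - u * z1 ^ 2) with (v * l1 ^ 2) by lra.
    replace (n - u * z2 ^ 2) with (v * l2 ^ 2) by lra; ring. }
  lra.
Qed.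

End WeightedPlane.

(** The deviation of the curvature [1 / rho] from half of [1 / r - 1 / rG], scaled by [2 * rG * r].
    It is half of [conic_z] once the parents admit a closed chain. *)
Definition axial (rG r rho : R) : R := 2 * rG * r / rho - (rG - r).

(** The geometry reduced to radii, an intermediate between chains and the test.
    [rG ^ 2 - 6 * rG * r + r ^ 2] stands for the squared distance of the parents' centres. *)
Definition steiner_radii (rG r r1 r2 r3 r4 : R) : Prop :=
  0 < r < rG /\ 0 < rG ^ 2 - 6 * rG * r + r ^ 2 /\
  axial rG r r1 + axial rG r r3 = 0 /\ axial rG r r2 + axial rG r r4 = 0 /\
  axial rG r r1 ^ 2 + axial rG r r2 ^ 2 = rG ^ 2 - 6 * rG * r + r ^ 2.

(** * The feasibility test *)

(** The bound puts [2 * rG * r / rho] between [rG - r - d] and [rG - r + d], whose product is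
    [4 * rG * r]; inverting gives the interval. *)
Lemma axial_interval (rG r d rho : R) :
  0 < r < rG -> 0 <= d -> d ^ 2 = rG ^ 2 - 6 * rG * r + r ^ 2 -> 0 < rho ->
  axial rG r rho ^ 2 <= d ^ 2 ->
  (rG - d - r) / 2 <= rho <= (rG + d - r) / 2.
Proof.
  intros Hr Hd Ed Hrho Hz.
  assert (Hdr : d < rG - r) by nra.
  assert (Hz' : - d <= axial rG r rho <= d) by nra.
  unfold axial in Hz'.
  set (b := 2 * rG * r / rho) in Hz'.
  assert (Eb : b * rho = 2 * rG * r) by (unfold b; field; lra).
  split.
  - apply (Rmult_le_reg_l (rG - r + d)); [lra |].
    assert (b * rho <= (rG - r + d) * rho) by nra; nra.
  - apply (Rmult_le_reg_l (rG - r - d)); [lra |].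
    assert ((rG - r - d) * rho <= b * rho) by nra; nra.
Qed.

Lemma axial_curvature (a A rho : R) : a <> 0 -> A <> 0 -> rho <> 0 ->
  axial (- (1 / A)) (1 / a) rho
  = 2 * (- (1 / A)) * (1 / a) * (1 / rho - (a + A) / 2).
Proof. intros Ha HA Hrho; unfold axial; field; auto. Qed.

(** Vieta's formulas give the sum [a + A] and the product of [1 / r2] and [1 / r4]. As all four
    curvatures sum to [2 * (a + A)], the other opposite pair also has sum [a + A]; the product
    yields the quadratic relation. *)
Lemma feasible_steiner_radii (r1 r2 r3 r4 : R) :
  0 < r1 -> 0 < r2 -> 0 < r3 -> 0 < r4 ->
  feasible r1 r2 r3 r4 -> exists rG r, steiner_radii rG r r1 r2 r3 r4.
Proof.
  intros h1 h2 h3 h4 (a & Ea & (Ha & HA & HR & HD) & _ & _ &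
                      xp & xm & [_ Hq] & Hxp & Hxm & HP).
  set (A := power_sum 1 (1 / r1) (1 / r2) (1 / r3) (1 / r4) / 2 - a) in *.
  assert (EI : 1 / r1 + 1 / r2 + 1 / r3 + 1 / r4 = 2 * (a + A))
    by (unfold A, power_sum; field; lra).
  clearbody A; clear Ea.
  assert (Hpow : 0 < - (1 / A) /\ 0 < 1 / a).
  { split; [| apply Rdiv_lt_0_compat; lra].
    replace (- (1 / A)) with (1 / - A) by (field; lra).
    apply Rdiv_lt_0_compat; lra. }
  assert (Hx : 1 / r2 + 1 / r4 = xp + xm /\ 1 / r2 * (1 / r4) = xp * xm).
  { apply Permutation_length_2 in HP as [[<- <-] | [<- <-]];
      split; field; split; lra. }
  destruct Hx as [Hs Hp].
  (* These three values determine the coefficients of the quadratic. *)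
  pose proof (Hq 0) as Q0; pose proof (Hq 1) as Q1; pose proof (Hq (- 1)) as Q2.
  clear Hq HP.
  assert (Es : xp + xm = a + A).
  { apply (Rmult_eq_reg_l
             (8 * (- (1 / A)) ^ 2 * (1 / a) ^ 2 * r1 ^ 2)).
    - transitivity (2 * (4 * - (1 / A) * (1 / a) * r1 ^ 2 * (- (1 / A) - 1 / a)));
        [lra | field; lra].
    - repeat apply Rmult_integral_contrapositive_currified; try apply pow_nonzero; lra. }
  assert (Ep : xp * xm = (1 / r1 - (a + A) / 2) ^ 2 - a * A).
  { apply (Rmult_eq_reg_l (4 * (- (1 / A)) ^ 2 * (1 / a) ^ 2 * r1 ^ 2)).
    - transitivity ((2 * - (1 / A) * (1 / a) - (- (1 / A) - 1 / a) * r1) ^ 2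
                    + 4 * - (1 / A) * (1 / a) * r1 ^ 2);
        [lra | field; lra].
    - repeat apply Rmult_integral_contrapositive_currified; try apply pow_nonzero; lra. }
  exists (- (1 / A)), (1 / a).
  unfold steiner_radii.
  rewrite !axial_curvature by lra.
  assert (E24 : 1 / r2 + 1 / r4 = a + A) by lra.
  assert (E13 : 1 / r1 + 1 / r3 = a + A) by lra.
  repeat split; try lra.
  - transitivity (2 * (- (1 / A)) * (1 / a) * ((1 / r1 + 1 / r3) - (a + A)));
      [lra | rewrite E13; ring].
  - transitivity (2 * (- (1 / A)) * (1 / a) * ((1 / r2 + 1 / r4) - (a + A)));
      [lra | rewrite E24; ring].
  - assert (E : (1 / r1 - (a + A) / 2) ^ 2 + (1 / r2 - (a + A) / 2) ^ 2
                = a * A + ((a + A) / 2) ^ 2).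
    { replace ((1 / r1 - (a + A) / 2) ^ 2) with (1 / r2 * (1 / r4) + a * A) by lra.
      replace (1 / r4) with (a + A - 1 / r2) by lra; field; lra. }
    transitivity ((2 * (- (1 / A)) * (1 / a)) ^ 2
                  * ((1 / r1 - (a + A) / 2) ^ 2 + (1 / r2 - (a + A) / 2) ^ 2));
      [ring | rewrite E; field; lra].
Qed.

(** With [m = (a + A) / 2] the curvatures are [m + p], [m + q], [m - p], [m - q], where
    [p ^ 2 + q ^ 2 = a * A + m ^ 2]. The power sums involve [p] and [q] only through this sum of
    squares. *)
Lemma steiner_radii_feasible (rG r r1 r2 r3 r4 : R) :
  0 < r1 -> 0 < r2 -> 0 < r3 -> 0 < r4 ->
  steiner_radii rG r r1 r2 r3 r4 -> feasible r1 r2 r3 r4.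
Proof.
  intros h1 h2 h3 h4 (Hr & HD & H13 & H24 & H12).
  set (a := 1 / r); set (A := - (1 / rG)).
  assert (Hax : forall rho, 0 < rho ->
            axial rG r rho = 2 * rG * r * (1 / rho - (a + A) / 2)).
  { intros rho Hrho; unfold axial, a, A; field; lra. }
  assert (HRr : 2 * rG * r <> 0) by nra.
  assert (E13 : 1 / r3 = a + A - 1 / r1).
  { rewrite !Hax in H13 by assumption.
    apply (Rmult_eq_reg_l (2 * rG * r)); [lra | exact HRr]. }
  assert (E24 : 1 / r4 = a + A - 1 / r2).
  { rewrite !Hax in H24 by assumption.
    apply (Rmult_eq_reg_l (2 * rG * r)); [lra | exact HRr]. }
  assert (E : (1 / r1 - (a + A) / 2) ^ 2 + (1 / r2 - (a + A) / 2) ^ 2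
              = a * A + ((a + A) / 2) ^ 2).
  { rewrite !Hax in H12 by assumption.
    apply (Rmult_eq_reg_l ((2 * rG * r) ^ 2)); [| apply pow_nonzero, HRr].
    transitivity (rG ^ 2 - 6 * rG * r + r ^ 2); [lra | unfold a, A; field; lra]. }
  exists a.
  unfold power_sum; rewrite E13, E24.
  replace (((1 / r1) ^ 1 + (1 / r2) ^ 1 + (a + A - 1 / r1) ^ 1 +
            (a + A - 1 / r2) ^ 1) / 2 - a) with A by (field; lra).
  cbv zeta.
  assert (ER : - (1 / A) = rG) by (unfold A; field; lra).
  assert (Er : 1 / a = r) by (unfold a; field; lra).
  rewrite ER, Er.
  assert (Ha : 0 < a) by (unfold a; apply Rdiv_lt_0_compat; lra).
  assert (HA : A < 0)
    by (assert (0 < 1 / rG) by (apply Rdiv_lt_0_compat; lra); unfold A; lra).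
  repeat split; try lra.
  - set (d := sqrt _).
    assert (Ed : d ^ 2 = rG ^ 2 - 6 * rG * r + r ^ 2)
      by (unfold d; apply pow2_sqrt; lra).
    assert (Hd : 0 <= d) by apply sqrt_pos.
    assert (Hsq : forall x y, x ^ 2 + y ^ 2 = d ^ 2 -> x ^ 2 <= d ^ 2)
      by (intros; nra).
    rewrite <- Ed in H12.
    repeat apply Forall_cons; trivial; apply axial_interval; trivial.
    + apply (Hsq _ _ H12).
    + apply (Hsq _ (axial rG r r1)); lra.
    + replace (axial rG r r3) with (- axial rG r r1) by lra.
      apply (Hsq _ (axial rG r r2)); lra.
    + replace (axial rG r r4) with (- axial rG r r2) by lra.
      apply (Hsq _ (axial rG r r1)); lra.
  - transitivity ((a + A) ^ 3 / 2 + 3 * (a + A) *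
       ((1 / r1 - (a + A) / 2) ^ 2 + (1 / r2 - (a + A) / 2) ^ 2));
      [lra | rewrite E; lra].
  - exists (1 / r2), (1 / r4).
    repeat split.
    + apply Rmult_integral_contrapositive_currified;
        [assert (0 < rG ^ 2 * r ^ 2) by (apply Rmult_lt_0_compat; nra); lra
        | apply pow_nonzero; lra].
    + intros x.
      assert (Ep : 1 / r2 * (1 / r4) = (1 / r1 - (a + A) / 2) ^ 2 - a * A)
        by (rewrite E24; lra).
      transitivity (4 * rG ^ 2 * r ^ 2 * r1 ^ 2 *
                    (x ^ 2 - (a + A) * x + ((1 / r1 - (a + A) / 2) ^ 2 - a * A))).
      * unfold a, A; field; lra.
      * rewrite <- Ep, E24; ring.
    + apply Rdiv_lt_0_compat; lra.
    + apply Rdiv_lt_0_compat; lra.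
    + replace (1 / (1 / r2)) with r2 by (field; lra).
      replace (1 / (1 / r4)) with r4 by (field; lra).
      apply Permutation_refl.
Qed.

(** * Circles tangent to two given circles *)

Lemma nested_circles_dist (g G : circle) :
  0 < radius g -> center g <> center G ->
  (forall P, on_circle P g -> in_open_disk P G) ->
  0 < edist (center g) (center G) /\
  edist (center g) (center G) + radius g < radius G.
Proof.
  destruct g as [[gx gy] r], G as [[Gx Gy] rG]; cbn [center radius].
  intros Hr Hne Hin.
  set (d := edist _ _).
  assert (Hd0 : 0 <= d) by apply sqrt_pos.
  assert (Ed : (gx - Gx) ^ 2 + (gy - Gy) ^ 2 = d ^ 2)
    by (apply edist_eq_iff; [exact Hd0 | reflexivity]).
  assert (Hd : 0 < d).
  { destruct Hd0 as [H | H]; [exact H | exfalso; apply Hne].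
    rewrite <- H in Ed.
    assert (0 <= (gx - Gx) ^ 2) by apply pow2_ge_0.
    assert (0 <= (gy - Gy) ^ 2) by apply pow2_ge_0.
    f_equal; apply Rminus_diag_uniq;
      (destruct (Req_dec (gx - Gx) 0), (Req_dec (gy - Gy) 0); nra). }
  split; [exact Hd |].
  (* The point of [g] farthest from the centre of [G]. *)
  set (P := (gx + r * (gx - Gx) / d, gy + r * (gy - Gy) / d)).
  assert (HP : edist P (Gx, Gy) = d + r).
  { apply edist_eq_iff; [lra |].
    transitivity (((gx - Gx) ^ 2 + (gy - Gy) ^ 2) * ((d + r) / d) ^ 2);
      [field; lra | rewrite Ed; field; lra]. }
  rewrite <- HP; apply Hin; apply edist_eq_iff; cbn [center radius]; [lra |].
  transitivity (((gx - Gx) ^ 2 + (gy - Gy) ^ 2) * (r / d) ^ 2);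
    [field; lra | rewrite Ed; field; lra].
Qed.

Section TangentToParents.

(* The outer parent is centred at the origin, the inner one at [(e, f)]. *)
Variables e f r rG : R.
Hypothesis (Hr : 0 < r).
Hypothesis (Hd : 0 < e ^ 2 + f ^ 2).
Hypothesis (HrG : 0 < (rG - r) ^ 2 - (e ^ 2 + f ^ 2)).

Let U := (rG + r) ^ 2 - (e ^ 2 + f ^ 2).
Let V := (rG - r) ^ 2 - (e ^ 2 + f ^ 2).

Definition tangent_to_parents (s t rho : R) : Prop :=
  0 < rho /\ (s - e) ^ 2 + (t - f) ^ 2 = (rho + r) ^ 2 /\
  s ^ 2 + t ^ 2 = (rG - rho) ^ 2.

(** The shift by [2 * (rG - r)] centres the conic at the origin. *)
Definition conic_z (rho : R) : R := V / rho - 2 * (rG - r).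
Definition conic_l (s t rho : R) : R := (t * e - s * f) / rho.

Lemma tangent_to_parents_axial (s t rho : R) : tangent_to_parents s t rho ->
  s * e + t * f = (e ^ 2 + f ^ 2 + (rG - rho) ^ 2 - (rho + r) ^ 2) / 2.
Proof. intros (_ & Hg & HG); lra. Qed.

(** Lagrange's identity expresses [(t * e - s * f) ^ 2] through [s ^ 2 + t ^ 2] and [s * e + t * f],
    which tangency makes polynomials in [rho]. *)
Lemma tangent_to_parents_conic (s t rho : R) : tangent_to_parents s t rho ->
  U * conic_z rho ^ 2 + 4 * V * conic_l s t rho ^ 2 = 4 * (e ^ 2 + f ^ 2) * U.
Proof.
  intros H; pose proof (tangent_to_parents_axial _ _ _ H) as Hx.
  destruct H as (Hrho & _ & HG).
  transitivity ((U * (V - 2 * (rG - r) * rho) ^ 2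
    + 4 * V * ((s ^ 2 + t ^ 2) * (e ^ 2 + f ^ 2) - (s * e + t * f) ^ 2)) / rho ^ 2).
  - unfold conic_z, conic_l; field; lra.
  - rewrite HG, Hx; unfold U, V; field; lra.
Qed.

(** The polarised form of the same computation; the law of cosines supplies the scalar product of
    the two centres. *)
Lemma tangent_pair_conic (s1 t1 rho1 s2 t2 rho2 : R) :
  tangent_to_parents s1 t1 rho1 -> tangent_to_parents s2 t2 rho2 ->
  (s1 - s2) ^ 2 + (t1 - t2) ^ 2 = (rho1 + rho2) ^ 2 ->
  U * conic_z rho1 * conic_z rho2 + 4 * V * conic_l s1 t1 rho1 * conic_l s2 t2 rho2
  = 4 * (e ^ 2 + f ^ 2) * (U - 2 * V).
Proof.
  intros H1 H2 H12.
  pose proof (tangent_to_parents_axial _ _ _ H1) as Hx1.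
  pose proof (tangent_to_parents_axial _ _ _ H2) as Hx2.
  destruct H1 as (Hrho1 & _ & HG1), H2 as (Hrho2 & _ & HG2).
  assert (Hs : s1 * s2 + t1 * t2 = rG ^ 2 - rG * (rho1 + rho2) - rho1 * rho2) by lra.
  transitivity ((U * (V - 2 * (rG - r) * rho1) * (V - 2 * (rG - r) * rho2)
    + 4 * V * ((s1 * s2 + t1 * t2) * (e ^ 2 + f ^ 2)
               - (s1 * e + t1 * f) * (s2 * e + t2 * f))) / (rho1 * rho2)).
  - unfold conic_z, conic_l; field; lra.
  - rewrite Hs, Hx1, Hx2; unfold U, V; field; lra.
Qed.

(** The first coordinate fixes [rho], hence the component of the centre along the axis; the second
    fixes the transverse component. *)
Lemma conic_coordinates_injective (s1 t1 rho1 s2 t2 rho2 : R) :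
  tangent_to_parents s1 t1 rho1 -> tangent_to_parents s2 t2 rho2 ->
  conic_z rho1 = conic_z rho2 -> conic_l s1 t1 rho1 = conic_l s2 t2 rho2 ->
  s1 = s2 /\ t1 = t2 /\ rho1 = rho2.
Proof.
  intros H1 H2 Hz Hl.
  pose proof (tangent_to_parents_axial _ _ _ H1) as Hx1.
  pose proof (tangent_to_parents_axial _ _ _ H2) as Hx2.
  destruct H1 as (Hrho1 & _ & _), H2 as (Hrho2 & _ & _).
  assert (Erho : rho1 = rho2).
  { unfold conic_z in Hz.
    assert (E : V * / rho1 = V * / rho2) by (unfold Rdiv in Hz; lra).
    apply Rmult_eq_reg_l in E; [| unfold V; lra].
    rewrite <- (Rinv_inv rho1), E; apply Rinv_inv. }
  subst rho2.
  assert (El : t1 * e - s1 * f = t2 * e - s2 * f).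
  { apply (Rmult_eq_reg_r (/ rho1)); [exact Hl | apply Rinv_neq_0_compat; lra]. }
  assert (Ex : s1 * e + t1 * f = s2 * e + t2 * f) by lra.
  repeat split; apply (Rmult_eq_reg_r (e ^ 2 + f ^ 2)); try lra.
  - transitivity (e * (s1 * e + t1 * f) - f * (t1 * e - s1 * f));
      [ring | rewrite Ex, El; ring].
  - transitivity (f * (s1 * e + t1 * f) + e * (t1 * e - s1 * f));
      [ring | rewrite Ex, El; ring].
Qed.

Lemma closed_chain_steiner_radii
    (s1 t1 r1 s2 t2 r2 s3 t3 r3 s4 t4 r4 : R) :
  r < rG ->
  tangent_to_parents s1 t1 r1 -> tangent_to_parents s2 t2 r2 ->
  tangent_to_parents s3 t3 r3 -> tangent_to_parents s4 t4 r4 ->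
  (s1 - s2) ^ 2 + (t1 - t2) ^ 2 = (r1 + r2) ^ 2 ->
  (s2 - s3) ^ 2 + (t2 - t3) ^ 2 = (r2 + r3) ^ 2 ->
  (s3 - s4) ^ 2 + (t3 - t4) ^ 2 = (r3 + r4) ^ 2 ->
  (s4 - s1) ^ 2 + (t4 - t1) ^ 2 = (r4 + r1) ^ 2 ->
  (s1, t1, r1) <> (s3, t3, r3) -> (s2, t2, r2) <> (s4, t4, r4) ->
  steiner_radii rG r r1 r2 r3 r4.
Proof.
  intros Hlt P1 P2 P3 P4 T12 T23 T34 T41 D13 D24.
  assert (HV : 0 < V) by exact HrG.
  assert (HU : 0 < U) by (unfold U; nra).
  destruct (four_cycle_on_conic U (4 * V) HU ltac:(lra)
    (4 * (e ^ 2 + f ^ 2) * U) (4 * (e ^ 2 + f ^ 2) * (U - 2 * V))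
    (conic_z r1) (conic_l s1 t1 r1) (conic_z r2) (conic_l s2 t2 r2)
    (conic_z r3) (conic_l s3 t3 r3) (conic_z r4) (conic_l s4 t4 r4))
    as (Hk & H13 & H24 & H12);
    try (apply tangent_to_parents_conic; assumption);
    try (apply tangent_pair_conic; assumption).
  - destruct (Req_dec (conic_z r1) (conic_z r3)) as [Ez | Nz]; [| tauto].
    destruct (Req_dec (conic_l s1 t1 r1) (conic_l s3 t3 r3)) as [El | Nl]; [| tauto].
    exfalso; apply D13.
    destruct (conic_coordinates_injective _ _ _ _ _ _ P1 P3 Ez El) as (-> & -> & ->).
    reflexivity.
  - destruct (Req_dec (conic_z r2) (conic_z r4)) as [Ez | Nz]; [| tauto].
    destruct (Req_dec (conic_l s2 t2 r2) (conic_l s4 t4 r4)) as [El | Nl]; [| tauto].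
    exfalso; apply D24.
    destruct (conic_coordinates_injective _ _ _ _ _ _ P2 P4 Ez El) as (-> & -> & ->).
    reflexivity.
  - apply Rmult_lt_0_compat; lra.
  (* This is [k = 0] divided by a positive factor. Since [U - V = 4 * rG * r], it determines both
     [V] and the distance of the parents. *)
  - assert (HUV : U = 2 * V) by nra.
    assert (ED : e ^ 2 + f ^ 2 = rG ^ 2 - 6 * rG * r + r ^ 2)
      by (unfold U, V in HUV; lra).
    assert (EV : V = 4 * rG * r) by (unfold V; lra).
    assert (Hz : forall rho, conic_z rho = 2 * axial rG r rho)
      by (intros rho; unfold conic_z, axial; rewrite EV; unfold Rdiv; ring).
    rewrite !Hz in *.
    repeat split; try lra.
    apply (Rmult_eq_reg_l (4 * U)); [| lra].
    rewrite <- ED; lra.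
Qed.

End TangentToParents.

Lemma steiner_4chain_radii (g G d1 d2 d3 d4 : circle) :
  steiner_4chain g G d1 d2 d3 d4 -> center g <> center G ->
  steiner_radii (radius G) (radius g) (radius d1) (radius d2) (radius d3) (radius d4).
Proof.
  intros (Hpos & Hin & Hnd & T12 & T23 & T34 & T41 & HT) Hne.
  rewrite !Forall_cons_iff in Hpos; rewrite !Forall_cons_iff in HT.
  destruct Hpos as (Hg & HG & H1 & H2 & H3 & H4 & _).
  destruct (nested_circles_dist g G Hg Hne Hin) as [Hd HdG].
  rewrite !NoDup_cons_iff in Hnd; destruct Hnd as (N1 & N2 & _).
  assert (D13 : d1 <> d3) by (intros ->; apply N1; cbn; tauto).
  assert (D24 : d2 <> d4) by (intros ->; apply N2; cbn; tauto).
  clear Hin N1 N2.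
  destruct g as [[gx gy] r], G as [[Gx Gy] rG], d1 as [[x1 y1] r1],
    d2 as [[x2 y2] r2], d3 as [[x3 y3] r3], d4 as [[x4 y4] r4].
  unfold externally_tangent, internally_tangent in *; cbn [center radius] in *.
  set (d := edist (gx, gy) (Gx, Gy)) in *.
  assert (Ed : (gx - Gx) ^ 2 + (gy - Gy) ^ 2 = d ^ 2)
    by (apply edist_eq_iff; [lra | reflexivity]).
  destruct HT as ((Tg1 & L1 & TG1) & (Tg2 & L2 & TG2) & (Tg3 & L3 & TG3)
                  & (Tg4 & L4 & TG4) & _).
  rewrite edist_eq_iff in T12, T23, T34, T41, Tg1, Tg2, Tg3, Tg4, TG1, TG2, TG3, TG4
    by lra.
  apply (closed_chain_steiner_radii (gx - Gx) (gy - Gy) r rG)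
    with (s1 := x1 - Gx) (t1 := y1 - Gy) (s2 := x2 - Gx) (t2 := y2 - Gy)
         (s3 := x3 - Gx) (t3 := y3 - Gy) (s4 := x4 - Gx) (t4 := y4 - Gy);
    unfold tangent_to_parents; repeat split; try lra; try nra.
  - intros E; apply D13; injection E as Ex Ey Er.
    repeat f_equal; lra.
  - intros E; apply D24; injection E as Ex Ey Er.
    repeat f_equal; lra.
Qed.

(** * Construction of the chain *)

Section Construction.

Variables rG r d : R.
Hypotheses (Hr : 0 < r < rG) (Hd : 0 < d).
Hypothesis Ed : d ^ 2 = rG ^ 2 - 6 * rG * r + r ^ 2.

Let outer := Circle (0, 0) rG.
Let inner := Circle (d, 0) r.

(* The abscissa is forced by the two tangencies; the factor [sqrt 2] turns the
   conic of the centres into the circle [axial ^ 2 + w ^ 2 = d ^ 2]. *)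
Definition conic_circle (rho w : R) : circle :=
  Circle ((rG * (rG - 3 * r) - (rG + r) * rho) / d, sqrt 2 * w * rho / d) rho.

Lemma axial_mul (rho : R) : 0 < rho ->
  axial rG r rho * rho = 2 * rG * r - (rG - r) * rho.
Proof. intros H; unfold axial; field; lra. Qed.

Lemma inner_inside_outer (P : R * R) : on_circle P inner -> in_open_disk P outer.
Proof.
  unfold on_circle, in_open_disk, inner, outer; cbn [center radius]; intros HP.
  pose proof (edist_triangle P (0, 0) (d, 0)) as Ht.
  assert (Edist : edist (d, 0) (0, 0) = d) by (apply edist_eq_iff; [lra | ring]).
  rewrite HP, Edist in Ht.
  assert (d < rG - r) by nra; lra.
Qed.

Lemma conic_circle_norm (rho w : R) :
  0 < rho -> axial rG r rho ^ 2 + w ^ 2 = d ^ 2 ->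
  fst (center (conic_circle rho w)) ^ 2 + snd (center (conic_circle rho w)) ^ 2
  = (rG - rho) ^ 2.
Proof.
  intros Hrho Hw; cbn [conic_circle center fst snd].
  pose proof (pow2_sqrt 2 ltac:(lra)) as Hs2.
  transitivity (((rG * (rG - 3 * r) - (rG + r) * rho) ^ 2
     + (sqrt 2) ^ 2 * (d ^ 2 * rho ^ 2 - (axial rG r rho * rho) ^ 2)) / d ^ 2).
  - replace (d ^ 2 * rho ^ 2 - (axial rG r rho * rho) ^ 2) with (w ^ 2 * rho ^ 2)
      by (replace (w ^ 2) with (d ^ 2 - axial rG r rho ^ 2) by lra; ring).
    field; lra.
  - rewrite Hs2, axial_mul by assumption.
    apply (Rmult_eq_reg_r (d ^ 2)); [| apply pow_nonzero; lra].
    unfold Rdiv; rewrite Rmult_assoc, Rinv_l, Rmult_1_r by (apply pow_nonzero; lra).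
    rewrite Ed; ring.
Qed.

Lemma conic_circle_tangent (rho w : R) :
  0 < rho -> axial rG r rho ^ 2 + w ^ 2 = d ^ 2 ->
  externally_tangent (conic_circle rho w) inner /\
  internally_tangent (conic_circle rho w) outer.
Proof.
  intros Hrho Hw.
  pose proof (conic_circle_norm rho w Hrho Hw) as HN.
  assert (Hlt : d < rG - r) by nra.
  (* Together with [Hlt] this gives [rho < rG]. *)
  assert (Hle : rho <= (rG + d - r) / 2).
  { apply axial_interval; trivial; [lra |].
    pose proof (pow2_ge_0 w); lra. }
  unfold externally_tangent, internally_tangent, inner, outer;
    cbn [conic_circle center radius fst snd] in *.
  set (x := (rG * (rG - 3 * r) - (rG + r) * rho) / d) in *.
  assert (Ex : x * d = rG * (rG - 3 * r) - (rG + r) * rho)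
    by (unfold x; field; lra).
  split; [| split; [lra |]]; apply edist_eq_iff; try lra.
Qed.

(* Successive circles differ by the quarter turn [(z, w) -> (- w, z)]. *)
Lemma conic_circle_next_tangent (rho1 w1 rho2 w2 : R) :
  0 < rho1 -> 0 < rho2 -> axial rG r rho1 ^ 2 + w1 ^ 2 = d ^ 2 ->
  axial rG r rho2 = - w1 -> w2 = axial rG r rho1 ->
  externally_tangent (conic_circle rho1 w1) (conic_circle rho2 w2).
Proof.
  intros H1 H2 Hw Ez2 Ew2.
  assert (Hw2 : axial rG r rho2 ^ 2 + w2 ^ 2 = d ^ 2) by (rewrite Ez2, Ew2; lra).
  pose proof (conic_circle_norm rho1 w1 H1 Hw) as N1.
  pose proof (conic_circle_norm rho2 w2 H2 Hw2) as N2.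
  pose proof (axial_mul rho1 H1) as M1; pose proof (axial_mul rho2 H2) as M2.
  pose proof (pow2_sqrt 2 ltac:(lra)) as Hs2.
  unfold externally_tangent; cbn [conic_circle center radius fst snd] in *.
  apply edist_eq_iff; [lra |].
  (* The norms of the centres being known, tangency is a condition on their scalar product. The
     quarter turn replaces [w1 * w2] by minus the product of the axial values. *)
  assert (HP : (rG * (rG - 3 * r) - (rG + r) * rho1) / d
               * ((rG * (rG - 3 * r) - (rG + r) * rho2) / d)
               + sqrt 2 * w1 * rho1 / d * (sqrt 2 * w2 * rho2 / d)
               = rG ^ 2 - rG * (rho1 + rho2) - rho1 * rho2); [| lra].
  apply (Rmult_eq_reg_r (d ^ 2)); [| apply pow_nonzero; lra].
  transitivity ((rG * (rG - 3 * r) - (rG + r) * rho1)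
                * (rG * (rG - 3 * r) - (rG + r) * rho2)
                - (sqrt 2) ^ 2 * (axial rG r rho1 * rho1) * (axial rG r rho2 * rho2)).
  - rewrite Ez2, Ew2; field; lra.
  - rewrite M1, M2, Hs2, Ed; ring.
Qed.

End Construction.

Lemma steiner_radii_chain (rG r r1 r2 r3 r4 : R) :
  0 < r1 -> 0 < r2 -> 0 < r3 -> 0 < r4 -> steiner_radii rG r r1 r2 r3 r4 ->
  exists g G d1 d2 d3 d4 : circle,
    steiner_4chain g G d1 d2 d3 d4 /\ center g <> center G /\
    radius d1 = r1 /\ radius d2 = r2 /\ radius d3 = r3 /\ radius d4 = r4.
Proof.
  intros h1 h2 h3 h4 (Hr & HD & H13 & H24 & H12).
  set (d := sqrt (rG ^ 2 - 6 * rG * r + r ^ 2)).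
  assert (Hd : 0 < d) by (apply sqrt_lt_R0; exact HD).
  assert (Ed : d ^ 2 = rG ^ 2 - 6 * rG * r + r ^ 2) by (apply pow2_sqrt; lra).
  rewrite <- Ed in H12.
  set (p := axial rG r r1) in *; set (q := axial rG r r2) in *.
  assert (E3 : axial rG r r3 = - p) by lra.
  assert (E4 : axial rG r r4 = - q) by lra.
  assert (Hpq : p <> 0 \/ q <> 0).
  { destruct (Req_dec p 0) as [Ep | Np]; [right; intros Eq | left; exact Np].
    rewrite Ep, Eq in H12; nra. }
  assert (Hinj : forall rho w rho' w', 0 < rho ->
            conic_circle rG r d rho w = conic_circle rG r d rho' w' ->
            rho = rho' /\ w = w').
  { intros rho w rho' w' Hrho E; injection E as _ Ey Erho; subst rho'.
    split; [reflexivity |].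
    assert (Hs : 0 < sqrt 2) by (apply sqrt_lt_R0; lra).
    apply (Rmult_eq_reg_l (sqrt 2 * rho / d)).
    - transitivity (sqrt 2 * w * rho / d); [field; lra |].
      rewrite Ey; field; lra.
    - apply Rgt_not_eq, Rdiv_lt_0_compat; [apply Rmult_lt_0_compat |]; lra. }
  (* Two equal points among the quarter turns of [(p, - q)] would force [p = q = 0], against
     [Hpq]. *)
  assert (Hneq : forall rho w rho' w', 0 < rho ->
            (axial rG r rho = axial rG r rho' -> w = w' -> p = 0 /\ q = 0) ->
            conic_circle rG r d rho w <> conic_circle rG r d rho' w').
  { intros rho w rho' w' Hrho H0 E.
    apply Hinj in E as [-> ->]; tauto. }
  (* The points [(p, - q)], [(q, p)], [(- p, q)], [(- q, - p)] are successive quarter turns. *)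
  exists (Circle (d, 0) r), (Circle (0, 0) rG),
    (conic_circle rG r d r1 (- q)), (conic_circle rG r d r2 p),
    (conic_circle rG r d r3 q), (conic_circle rG r d r4 (- p)).
  split; [| cbn [conic_circle center radius]; repeat split; intros E; injection E; lra].
  repeat apply conj.
  - repeat apply Forall_cons; cbn [conic_circle radius]; trivial; lra.
  - intros P; apply inner_inside_outer; trivial.
  - repeat apply NoDup_cons; try apply NoDup_nil; cbn [In];
      intros H; decompose [or] H; try tauto; clear H;
      match goal with E : conic_circle _ _ _ _ _ = _ |- _ =>
        revert E; apply Hneq; trivial end;
      fold p q; rewrite ?E3, ?E4; lra.
  - apply conic_circle_next_tangent; trivial; fold p q; lra.
  - apply conic_circle_next_tangent; trivial; fold p q; lra.
  - apply conic_circle_next_tangent; trivial; rewrite ?E3, ?E4; lra.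
  - apply conic_circle_next_tangent; trivial; rewrite ?E3, ?E4; fold p q; lra.
  - repeat apply Forall_cons; trivial; apply conic_circle_tangent;
      trivial; rewrite ?E3, ?E4; fold p q; lra.
Qed.

(** Concentric parents also carry chains, of four equal circles, but then
    [rG ^ 2 - 6 * rG * r + r ^ 2 = 0], which the strict inequality of the test rules out; hence the
    condition on the centres. *)
Theorem theorem1 (r1 r2 r3 r4 : R) (h1 : 0 < r1) (h2 : 0 < r2)
    (h3 : 0 < r3) (h4 : 0 < r4) :
  (exists g G d1 d2 d3 d4 : circle,
      steiner_4chain g G d1 d2 d3 d4 /\ center g <> center G /\
      radius d1 = r1 /\ radius d2 = r2 /\ radius d3 = r3 /\ radius d4 = r4)
  <-> feasible r1 r2 r3 r4.
Proof.
  split.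
  - intros (g & G & d1 & d2 & d3 & d4 & Hc & Hne & <- & <- & <- & <-).
    apply (steiner_radii_feasible (radius G) (radius g)); trivial.
    apply steiner_4chain_radii; trivial.
  - intros H; apply feasible_steiner_radii in H as (rG & r & H); trivial.
    apply (steiner_radii_chain rG r); trivial.
Qed.
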